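(* Let $w$ be a word in $x,y,x^{-1},y^{-1}$ such that a finite group $G$ is solvable if and only if for some $n\ge 1$ the identity ${}^{w}u_n(x,y)\equiv 1$ holds in $G$. Let $F=F(x,y)$ be the free group in two variables and let $\widehat F$ be its profinite completion. Let $v_1,v_2,\ldots,v_m,\ldots$ be any subsequence of the sequence $({}^{w}u_n)_{n\ge1}$ that converges in $\widehat F$, with limit $f\in\widehat F$. Then the identity $f\equiv 1$ defines the profinite variety of prosolvable groups; that is, a profinite group $\Gamma$ is prosolvable if and only if the profinite identity $f\equiv 1$ holds in $\Gamma$.
   Context: For a word $w$ in $x,y,x^{-1},y^{-1}$, the words ${}^{w}u_n(x,y)$ are defined by ${}^{w}u_1=w$ and ${}^{w}u_{n+1}=[x\,{}^{w}u_n\,x^{-1},\;y\,{}^{w}u_n\,y^{-1}]$, where $[g,h]=ghg^{-1}h^{-1}$. The identity $u(x,y)\equiv1$ holds in a group $G$ if $u(g,h)=1$ for all $g,h\in G$. For $f\in\widehat F$, the profinite identity $f\equiv 1$ holds in a profinite group $\Gamma$ if $\mu(f)=1$ for every continuous homomorphism $\mu:\widehat F\to\Gamma$. A profinite group is prosolvable if it is an inverse limit of finite solvable groups (equivalently, all its quotients by open normal subgroups are solvable). *)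

(* Defs.v *)
From HB Require Import structures.
From mathcomp Require Import all_boot all_order all_algebra all_fingroup all_solvable.
From mathcomp Require Import all_classical all_reals all_analysis.

Set Implicit Arguments.
Unset Strict Implicit.
Unset Printing Implicit Defensive.

Local Open Scope classical_set_scope.
Local Open Scope group_scope.

(* A letter (x, b) stands for x if b = false and for x^-1 if b = true; words  *)
(* need not be reduced.                                                       *)

Definition letter (X : Type) : Type := (X * bool)%type.

Definition word (X : Type) : Type := seq (letter X).

Definition letter_inv (X : Type) (l : letter X) : letter X := (l.1, ~~ l.2).

Definition word_inv (X : Type) (u : word X) : word X :=
  rev (map (@letter_inv X) u).

(* The convention is [g,h] = g h g^-1 h^-1, which is not MathComp's [~ g, h]. *)
Definition word_comm (X : Type) (u v : word X) : word X :=
  u ++ v ++ word_inv u ++ word_inv v.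

Definition word_eval (X : Type) (G : groupType) (rho : X -> G) (u : word X) : G :=
  \prod_(l <- u) (if l.2 then (rho l.1)^-1 else rho l.1).

Section FreeGroup.
Variable X : choiceType.

Definition push_letter (l : letter X) (u : word X) : word X :=
  if u is k :: v then if k == letter_inv l then v else l :: u else [:: l].

Definition reduce (u : word X) : word X := foldr push_letter [::] u.

Definition reduced (u : word X) : bool := reduce u == u.

Record free_group : Type := FreeGroup {
  free_word : word X;
  free_wordP : reduced free_word
}.
HB.instance Definition _ := [isSub for free_word].
HB.instance Definition _ := [Choice of free_group by <:].

Lemma letter_invK : involutive (@letter_inv X).
Proof. by case=> x b; rewrite /letter_inv /= negbK. Qed.

Fixpoint no_cancel (u : word X) : bool :=
  if u is l :: v then
    (if v is k :: _ then k != letter_inv l else true) && no_cancel v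
  else true.

Lemma push_no_cancel l u : no_cancel u -> no_cancel (push_letter l u).
Proof.
case: u => [|k v] //= /andP[h1 h2]; case: eqP => [//|/eqP hk] /=.
by rewrite hk h1 h2.
Qed.

Lemma reduce_no_cancel u : no_cancel (reduce u).
Proof. by elim: u => //= l u IH; exact: push_no_cancel. Qed.

Lemma no_cancel_reduce u : no_cancel u -> reduce u = u.
Proof.
elim: u => //= l u IH /andP[h1 /IH ->].
by case: u h1 {IH} => //= k v /negbTE ->.
Qed.

Lemma reduce_reduced u : reduced (reduce u).
Proof. by apply/eqP/no_cancel_reduce/reduce_no_cancel. Qed.

Lemma push_letterK l u :
  no_cancel u -> push_letter l (push_letter (letter_inv l) u) = u.
Proof.
case: u => [|k v] /= => [_|/andP[h1 _]]; first by rewrite eqxx.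
rewrite letter_invK; case: eqP => [e|_] /=; last by rewrite eqxx.
by rewrite e; case: v h1 => //= m v; rewrite e => /negbTE ->.
Qed.

Lemma foldr_push_reduce u r : no_cancel r ->
  foldr push_letter r (reduce u) = foldr push_letter r u.
Proof.
move=> hr; have hf v : no_cancel (foldr push_letter r v).
  by elim: v => //= l v IH; exact: push_no_cancel.
have hp l v : no_cancel v ->
    foldr push_letter r (push_letter l v) = push_letter l (foldr push_letter r v).
  case: v => //= k v _; case: eqP => [->|//].
  by rewrite push_letterK.
elim: u => //= l u IH; rewrite hp ?IH //; exact: reduce_no_cancel.
Qed.

Lemma reduce_catl u v : reduce (reduce u ++ v) = reduce (u ++ v).
Proof.
by rewrite /reduce !foldr_cat foldr_push_reduce //; exact: reduce_no_cancel.
Qed.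

Lemma reduce_catr u v : reduce (u ++ reduce v) = reduce (u ++ v).
Proof.
rewrite /reduce !foldr_cat; congr foldr.
by apply: no_cancel_reduce; exact: reduce_no_cancel.
Qed.

Lemma letter_inv_word_inv (u : word X) : word_inv (word_inv u) = u.
Proof.
rewrite /word_inv map_rev revK -map_comp -[RHS]map_id.
by apply: eq_map => l /=; rewrite letter_invK.
Qed.

Lemma reduce_word_invV u : reduce (u ++ word_inv u) = [::].
Proof.
elim: u => //= l u IH.
rewrite /word_inv /= rev_cons -cats1 catA -reduce_catl [reduce (u ++ _)]IH /=.
by rewrite eqxx.
Qed.

Definition free_class (u : word X) : free_group :=
  FreeGroup (reduce_reduced u).

Definition free_mul (a b : free_group) : free_group :=
  free_class (free_word a ++ free_word b).

Definition free_one : free_group := free_class [::].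

Definition free_inv (a : free_group) : free_group :=
  free_class (word_inv (free_word a)).

Lemma free_mulA : associative free_mul.
Proof.
by move=> a b c; apply: val_inj; rewrite /= reduce_catl reduce_catr catA.
Qed.

Lemma free_mul1 : left_id free_one free_mul.
Proof. by move=> [a /= ra]; apply: val_inj; rewrite /= (eqP ra). Qed.

Lemma free_mulr1 : right_id free_one free_mul.
Proof. by move=> [a /= ra]; apply: val_inj; rewrite /= cats0 (eqP ra). Qed.

Lemma free_mulV : left_inverse free_one free_inv free_mul.
Proof.
move=> [a ra]; apply: val_inj; rewrite /= reduce_catl.
by rewrite -{2}[a]letter_inv_word_inv reduce_word_invV.
Qed.

Lemma free_mulrV : right_inverse free_one free_inv free_mul.
Proof.
by move=> [a ra]; apply: val_inj; rewrite /= reduce_catr reduce_word_invV.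
Qed.

HB.instance Definition _ := isGroup.Build free_group
  free_mulA free_mul1 free_mulr1 free_mulV free_mulrV.

Definition free_gen (x : X) : free_group := free_class [:: (x, false)].

End FreeGroup.

HB.mixin Record isTopologicalGroup G & monoid.Group G & Topological G := {
  mulg_continuous : continuous (fun p : G * G => p.1 * p.2);
  invg_continuous : continuous (fun x : G => x^-1)
}.

#[short(type="topGroupType")]
HB.structure Definition TopologicalGroup :=
  {G of isTopologicalGroup G & monoid.Group G & Topological G}.

Definition continuous_hom (G H : topGroupType) (f : G -> H) : Prop :=
  {morph f : x y / x * y} /\ continuous f.

Definition topologically_isomorphic (G H : topGroupType) : Prop :=
  exists f : G -> H, exists g : H -> G,
    [/\ cancel f g, cancel g f, continuous_hom f & continuous_hom g].

(* The index set is directed by a preorder.  It is an eqType only because the *)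
(* library's lemmas on product topologies require it; classically every type  *)
(* is one.                                                                    *)
Record inverse_system : Type := InverseSystem {
  sys_index : eqType;
  sys_le : sys_index -> sys_index -> Prop;
  sys_group : sys_index -> finGroupType;
  sys_map : forall i j, sys_le i j -> sys_group j -> sys_group i;
  sys_inhabited : inhabited sys_index;
  sys_le_refl : forall i, sys_le i i;
  sys_le_trans : forall i j k, sys_le i j -> sys_le j k -> sys_le i k;
  sys_directed : forall i j, exists k, sys_le i k /\ sys_le j k;
  sys_mapM : forall i j (ij : sys_le i j), {morph sys_map ij : x y / x * y};
  sys_map_id : forall i (ii : sys_le i i) x, sys_map ii x = x;
  sys_map_comp : forall i j k (ij : sys_le i j) (jk : sys_le j k)
    (ik : sys_le i k) x, sys_map ij (sys_map jk x) = sys_map ik x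
}.

Section InverseLimit.
Variable S : inverse_system.

Definition sys_prod : topologicalType :=
  prod_topology (fun i : sys_index S => discrete_topology (sys_group i)).

Definition coherent : set sys_prod :=
  [set x | forall i j (ij : sys_le i j), sys_map ij (x j) = x i].

Definition inverse_limit : Type := set_type coherent.
HB.instance Definition _ := Topological.on inverse_limit.

Lemma limP (x : inverse_limit) : coherent (val x).
Proof. by have := valP x; rewrite inE. Qed.

Lemma sys_map1 (i j : sys_index S) (ij : sys_le i j) :
  sys_map ij (1 : sys_group j) = 1.
Proof.
by apply: (@mulgI _ (sys_map ij 1)); rewrite -sys_mapM !mulg1.
Qed.

Lemma sys_mapV (i j : sys_index S) (ij : sys_le i j) (x : sys_group j) :
  sys_map ij x^-1 = (sys_map ij x)^-1.
Proof.
by apply: (@mulgI _ (sys_map ij x)); rewrite -sys_mapM !mulgV sys_map1.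
Qed.

Lemma coherent_mul (x y : inverse_limit) :
  (fun i : sys_index S => (val x i : sys_group i) * val y i) \in coherent.
Proof. by rewrite inE => i j ij; rewrite sys_mapM !limP. Qed.

Lemma coherent_inv (x : inverse_limit) :
  (fun i : sys_index S => (val x i : sys_group i)^-1) \in coherent.
Proof. by rewrite inE => i j ij; rewrite sys_mapV !limP. Qed.

Lemma coherent_one : (fun i : sys_index S => 1 : sys_group i) \in coherent.
Proof. by rewrite inE => i j ij; rewrite sys_map1. Qed.

Definition lim_mul (x y : inverse_limit) : inverse_limit :=
  exist (fun z => z \in coherent) _ (coherent_mul x y).
Definition lim_inv (x : inverse_limit) : inverse_limit :=
  exist (fun z => z \in coherent) _ (coherent_inv x).
Definition lim_one : inverse_limit := exist (fun z => z \in coherent) _ coherent_one.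

Lemma lim_mulA : associative lim_mul.
Proof.
by move=> x y z; apply: val_inj; apply/functional_extensionality_dep => i;
  rewrite /= mulgA.
Qed.

Lemma lim_mul1 : left_id lim_one lim_mul.
Proof.
by move=> x; apply: val_inj; apply/functional_extensionality_dep => i;
  rewrite /= mul1g.
Qed.

Lemma lim_mulr1 : right_id lim_one lim_mul.
Proof.
by move=> x; apply: val_inj; apply/functional_extensionality_dep => i;
  rewrite /= mulg1.
Qed.

Lemma lim_mulV : left_inverse lim_one lim_inv lim_mul.
Proof.
by move=> x; apply: val_inj; apply/functional_extensionality_dep => i;
  rewrite /= mulVg.
Qed.

Lemma lim_mulrV : right_inverse lim_one lim_inv lim_mul.
Proof.
by move=> x; apply: val_inj; apply/functional_extensionality_dep => i;
  rewrite /= mulgV.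
Qed.

HB.instance Definition _ := isGroup.Build inverse_limit
  lim_mulA lim_mul1 lim_mulr1 lim_mulV lim_mulrV.

Definition lim_proj (i : sys_index S) (x : inverse_limit) : sys_group i :=
  val x i.

Lemma lim_proj_near i (x : inverse_limit) :
  \forall y \near x, lim_proj i y = lim_proj i x.
Proof.
have c : continuous (fun y : inverse_limit =>
    (val y : sys_prod) i : discrete_topology (sys_group i)).
  move=> y; apply: (@continuous_comp _ _ _ (val : inverse_limit -> sys_prod)
    (fun z : sys_prod => z i : discrete_topology (sys_group i))).
    exact: initial_continuous.
  exact: (@proj_continuous _
    (fun i : sys_index S => discrete_topology (sys_group i)) i).
exact: (c x [set lim_proj i x] (discrete_set1 _)).
Qed.

Lemma lim_continuous (T : topologicalType) (f : T -> inverse_limit) :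
  (forall i t, \forall s \near t, lim_proj i (f s) = lim_proj i (f t)) ->
  continuous f.
Proof.
move=> hf; apply: continuous_comp_initial => t.
apply/cvg_sup => i; apply/cvg_image.
  by apply/seteqP; split => // z _ /=; exists (dfwith (val (f t)) i z) => //;
    rewrite dfwithin.
move=> A /principal_filterP Az.
exists ((fun z : sys_prod => z i) @^-1` A); last first.
  by rewrite image_preimage //; apply/seteqP; split => // z _ /=;
    exists (dfwith (val (f t)) i z) => //; rewrite dfwithin.
by have := hf i t; apply: filterS => s /= e;
  change (A (lim_proj i (f s))); rewrite e.
Qed.

Lemma lim_mul_continuous :
  continuous (fun p : inverse_limit * inverse_limit => p.1 * p.2).
Proof.
apply: lim_continuous => i [x y].
exists ([set a | lim_proj i a = lim_proj i x],
        [set b | lim_proj i b = lim_proj i y]) => /=.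
  by split; exact: lim_proj_near.
by move=> [a b] [/= ea eb]; rewrite /lim_proj /= in ea eb *; rewrite ea eb.
Qed.

Lemma lim_inv_continuous : continuous (fun x : inverse_limit => x^-1).
Proof.
apply: lim_continuous => i x; have := lim_proj_near i x.
by apply: filterS => y; rewrite /lim_proj /= => ->.
Qed.

HB.instance Definition _ := isTopologicalGroup.Build inverse_limit
  lim_mul_continuous lim_inv_continuous.

End InverseLimit.

Definition pro (C : finGroupType -> Prop) (G : topGroupType) : Prop :=
  exists S : inverse_system, (forall i : sys_index S, C (sys_group i)) /\
    topologically_isomorphic G (inverse_limit S).

Definition finite_solvable (G : finGroupType) : Prop := solvable [set: G]%G.

Definition profinite : topGroupType -> Prop := pro (fun=> True).

Definition prosolvable : topGroupType -> Prop := pro finite_solvable.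

(* The profinite completion of G: the inverse limit of the quotients G / N    *)
(* over the normal subgroups N of finite index, ordered by reverse inclusion. *)

Section Completion.
Variable G : groupType.
Implicit Types (A B : set G) (g h : G).

Definition set_mul A B : set G := [set a * b | a in A & b in B].

Definition coset_by A g : set G := [set g * a | a in A].

Record fin_index_normal : Type := FinIndexNormal {
  fin_set :> set G;
  fin1 : fin_set 1;
  finM : forall g h, fin_set g -> fin_set h -> fin_set (g * h);
  finV : forall g, fin_set g -> fin_set g^-1;
  finJ : forall g h, fin_set g -> fin_set (g ^ h);
  fin_index : finite_set (range (coset_by fin_set))
}.

HB.instance Definition _ := gen_eqMixin fin_index_normal.

Implicit Types K N M : fin_index_normal.

Lemma coset_byP N g h : coset_by N g h <-> fin_set N (g^-1 * h).
Proof.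
split=> [[n nN <-]|Nh]; first by rewrite mulKg.
by exists (g^-1 * h) => //; rewrite mulVKg.
Qed.

Lemma coset_by_eq N g h : coset_by N g = coset_by N h <-> fin_set N (g^-1 * h).
Proof.
split=> [e|Ngh].
  by apply/coset_byP; rewrite e; apply/coset_byP; rewrite mulVg; exact: fin1.
apply/seteqP; split => k /coset_byP Nk; apply/coset_byP.
  have -> : h^-1 * k = (g^-1 * h)^-1 * (g^-1 * k) 
    by rewrite invgM invgK mulgA mulgK.
  by apply: finM => //; apply: finV.
have -> : g^-1 * k = (g^-1 * h) * (h^-1 * k) by rewrite mulgA mulgK.
exact: finM.
Qed.

Lemma coset_by_mul N M g h : N `<=` M ->
  set_mul (coset_by N g) (coset_by M h) = coset_by M (g * h).
Proof.
move=> NM; apply/seteqP; split => [_ [_ [n Nn <-] [_ [m Mm <-] <-]]|_ [m Mm <-]].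
  exists (n ^ h * m).
    by apply: finM => //; apply: finJ; exact: NM.
  by rewrite /conjg -!mulgA mulVKg.
exists g; first by exists 1; [exact: fin1|rewrite mulg1].
by exists (h * m); [exists m|rewrite mulgA].
Qed.

Lemma coset_by_inv N g :
  [set a^-1 | a in coset_by N g] = coset_by N g^-1.
Proof.
apply/seteqP; split => [_ [_ [n Nn <-] <-]|_ [n Nn <-]].
  exists (n^-1 ^ g^-1); first by apply: finJ; exact: finV.
  by rewrite /conjg invgK invgM !mulgA mulVg mul1g.
exists (n^-1 * g); last by rewrite invgM invgK.
exists (n^-1 ^ g); first by apply: finJ; exact: finV.
by rewrite /conjg mulVKg.
Qed.

Definition quotient_by N : Type := set_type (range (coset_by N)).

Section Quotient.
Variable N : fin_index_normal.

HB.instance Definition _ := Choice.on (quotient_by N).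

Lemma quotient_by_enum : {s : seq (quotient_by N) | Finite.axiom s}.
Proof.
apply: cid; have /finite_seqP[s es] := fin_index N.
have hs : range (coset_by N) `<=` [set` s] by rewrite es.
exists (undup (pmap insub s)) => q.
rewrite count_uniq_mem ?undup_uniq // mem_undup mem_pmap_sub.
suff -> : val q \in s by [].
exact: hs (set_mem (valP q)).
Qed.

Lemma quotient_by_pickleK : pcancel
  (fun q : quotient_by N => index q (sval quotient_by_enum))
  (fun n => onth (sval quotient_by_enum) n).
Proof.
move=> q; case: quotient_by_enum => s hs /=.
have qs : q \in s by rewrite -has_pred1 has_count hs.
by rewrite onthE (nth_map q) ?index_mem // nth_index.
Qed.

HB.instance Definition _ :=
  isCountable.Build (quotient_by N) quotient_by_pickleK.
HB.instance Definition _ :=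
  fintype.isFinite.Build (quotient_by N) (svalP quotient_by_enum).

Lemma quotientP (q : quotient_by N) : exists g, coset_by N g = val q.
Proof. by have := valP q; rewrite inE => -[g _ <-]; exists g. Qed.

Lemma quotient_projP g : coset_by N g \in range (coset_by N).
Proof. by rewrite inE; exists g. Qed.

Definition quotient_proj g : quotient_by N :=
  exist (fun A => A \in range (coset_by N)) _ (quotient_projP g).

Lemma quotient_mulP (q r : quotient_by N) :
  set_mul (val q) (val r) \in range (coset_by N).
Proof.
have [[g <-] [h <-]] := (quotientP q, quotientP r).
by rewrite coset_by_mul // quotient_projP.
Qed.

Lemma quotient_invP (q : quotient_by N) :
  [set a^-1 | a in val q] \in range (coset_by N).
Proof. by have [g <-] := quotientP q; rewrite coset_by_inv quotient_projP. Qed.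

Definition quotient_mul (q r : quotient_by N) : quotient_by N :=
  exist (fun A => A \in range (coset_by N)) _ (quotient_mulP q r).
Definition quotient_inv (q : quotient_by N) : quotient_by N :=
  exist (fun A => A \in range (coset_by N)) _ (quotient_invP q).

Lemma quotient_projK (q : quotient_by N) : exists g, quotient_proj g = q.
Proof. by have [g e] := quotientP q; exists g; exact: val_inj. Qed.

Lemma quotient_projM g h :
  quotient_mul (quotient_proj g) (quotient_proj h) = quotient_proj (g * h).
Proof. by apply: val_inj; rewrite /= coset_by_mul. Qed.

Lemma quotient_projV g : quotient_inv (quotient_proj g) = quotient_proj g^-1.
Proof. by apply: val_inj; rewrite /= coset_by_inv. Qed.

Lemma quotient_mulA : associative quotient_mul.
Proof.
move=> q r t; have [g <-] := quotient_projK q; have [h <-] := quotient_projK r.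
by have [k <-] := quotient_projK t; rewrite !quotient_projM mulgA.
Qed.

Lemma quotient_mul1 : left_id (quotient_proj 1) quotient_mul.
Proof. by move=> q; have [g <-] := quotient_projK q; rewrite quotient_projM mul1g. Qed.

Lemma quotient_mulr1 : right_id (quotient_proj 1) quotient_mul.
Proof. by move=> q; have [g <-] := quotient_projK q; rewrite quotient_projM mulg1. Qed.

Lemma quotient_mulV : left_inverse (quotient_proj 1) quotient_inv quotient_mul.
Proof.
move=> q; have [g <-] := quotient_projK q.
by rewrite quotient_projV quotient_projM mulVg.
Qed.

Lemma quotient_mulrV : right_inverse (quotient_proj 1) quotient_inv quotient_mul.
Proof.
move=> q; have [g <-] := quotient_projK q.
by rewrite quotient_projV quotient_projM mulgV.
Qed.

HB.instance Definition _ := isGroup.Build (quotient_by N)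
  quotient_mulA quotient_mul1 quotient_mulr1 quotient_mulV quotient_mulrV.

End Quotient.

Lemma quotient_mapP N M (NM : N `<=` M) (q : quotient_by N) :
  set_mul (val q) M \in range (coset_by M).
Proof.
have [g <-] := quotientP q; have {1}-> : M = coset_by M 1 :> set G.
  by apply/seteqP; split=> x; rewrite coset_byP invg1 mul1g.
by rewrite coset_by_mul // quotient_projP.
Qed.

(* The canonical map G / N -> G / M, sending the coset A = gN to A M = gM.    *)
Definition quotient_map M N (NM : N `<=` M) (q : quotient_by N) : quotient_by M :=
  exist (fun A => A \in range (coset_by M)) _ (quotient_mapP NM q).

Lemma quotient_map_proj M N (NM : N `<=` M) g :
  quotient_map NM (quotient_proj N g) = quotient_proj M g.
Proof.
apply: val_inj => /=; have -> : set_mul (coset_by N g) M =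
    set_mul (coset_by N g) (coset_by M 1).
  by congr set_mul; apply/seteqP; split=> x; rewrite coset_byP invg1 mul1g.
by rewrite coset_by_mul // mulg1.
Qed.

Lemma fullP : finite_set (range (coset_by [set: G])).
Proof.
apply: (@sub_finite_set _ _ [set [set: G]]); last exact: finite_set1.
move=> _ [g _ <-]; apply/seteqP; split=> // x _.
by exists (g^-1 * x) => //; rewrite mulVKg.
Qed.

Definition fin_full : fin_index_normal :=
  @FinIndexNormal [set: G] I (fun _ _ _ _ => I) (fun _ _ => I)
    (fun _ _ _ => I) fullP.

Lemma capP N M : finite_set (range (coset_by (N `&` M))).
Proof.
apply: (@sub_finite_set _ _ ((fun AB : set G * set G => AB.1 `&` AB.2) @`
    (range (coset_by N) `*` range (coset_by M)))).
  move=> _ [g _ <-]; exists (coset_by N g, coset_by M g) => /=.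
    by split; exists g.
  apply/seteqP; split=> x /=.
    by rewrite !coset_byP => -[Nx Mx]; exists (g^-1 * x) => //; rewrite mulVKg.
  by move=> [y [Ny My] <-]; split; exists y.
by apply: finite_image; apply: finite_setX; exact: fin_index.
Qed.

Definition fin_cap N M : fin_index_normal :=
  @FinIndexNormal (N `&` M) (conj (fin1 N) (fin1 M))
    (fun g h gP hP => conj (finM gP.1 hP.1) (finM gP.2 hP.2))
    (fun g gP => conj (finV gP.1) (finV gP.2))
    (fun g h gP => conj (finJ h gP.1) (finJ h gP.2)) (capP N M).

Lemma quotient_mapM M N (NM : N `<=` M) : {morph quotient_map NM : x y / x * y}.
Proof.
move=> q r; have [g <-] := quotient_projK q; have [h <-] := quotient_projK r.
by rewrite -[_ * _]/(quotient_mul _ _) quotient_projM !quotient_map_proj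
  -quotient_projM.
Qed.

Lemma quotient_map_id N (NN : N `<=` N) q : quotient_map NN q = q.
Proof. by have [g <-] := quotient_projK q; rewrite quotient_map_proj. Qed.

Lemma quotient_map_comp K M N (MK : M `<=` K) (NM : N `<=` M) (NK : N `<=` K) q :
  quotient_map MK (quotient_map NM q) = quotient_map NK q.
Proof. by have [g <-] := quotient_projK q; rewrite !quotient_map_proj. Qed.

Lemma fin_directed N M : exists K : fin_index_normal, K `<=` N /\ K `<=` M.
Proof. by exists (fin_cap N M); split=> x []. Qed.

Definition quotient_system : inverse_system :=
  @InverseSystem fin_index_normal (fun M N => N `<=` M)
    (fun N => quotient_by N : finGroupType) quotient_map
    (inhabits fin_full) (fun N => @subset_refl _ N)
    (fun K M N MK NM => subset_trans NM MK)
    fin_directed quotient_mapM quotient_map_id quotient_map_comp.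

Definition profinite_completion : topGroupType := inverse_limit quotient_system.

Lemma to_profinite_completionP g :
  (fun N : sys_index quotient_system => quotient_proj N g)
    \in @coherent quotient_system.
Proof. by rewrite inE => i j ij; rewrite /= quotient_map_proj. Qed.

Definition to_profinite_completion g : profinite_completion :=
  exist (fun z => z \in @coherent quotient_system) _
    (to_profinite_completionP g).

End Completion.

(* x is the generator false and y the generator true.          *)

Definition word2 : Type := word bool.

Definition word_x : word2 := [:: (false, false)].
Definition word_y : word2 := [:: (true, false)].

Definition word2_eval (G : groupType) (g h : G) (u : word2) : G :=
  word_eval (fun b : bool => if b then h else g) u.

Definition free2 : groupType := free_group bool.

Definition free2_of_word (u : word2) : free2 := word_eval (@free_gen bool) u.

(* The sequence is indexed from 1: u_seq w 1 = w, and the value at 0 is junk. *)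
Definition u_seq (w : word2) (n : nat) : word2 :=
  iter n.-1 (fun u => word_comm (word_x ++ u ++ word_inv word_x)
                                (word_y ++ u ++ word_inv word_y)) w.

Definition identity_holds (G : groupType) (u : word2) : Prop :=
  forall g h : G, word2_eval g h u = 1.

Definition profinite_identity_holds (Gamma : topGroupType)
    (f : profinite_completion free2) : Prop :=
  forall mu : profinite_completion free2 -> Gamma, continuous_hom mu -> mu f = 1.

(* Main.v *)
(* Values of the words [u_n] at a pair of a group stay trivial once they are
   trivial, and a continuous homomorphism from the profinite completion to a
   finite group takes at [f] the value it takes at [v_m], for all large [m].
   Hence [f] dies in every finite solvable quotient, and so in their limit.
   Conversely, if [f = 1] holds in [lim S_i], every pair in the image [H_i] of
   [lim S_i] in [S_i] lifts to [lim S_i], so some [u_n] vanishes on it.  As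
   [H_i] has finitely many pairs, one [n] serves them all and [H_i] is
   solvable; and [lim H_i] is isomorphic to [lim S_i]. *)

Require Import Defs.
From HB Require Import structures.
From mathcomp Require Import all_boot all_order all_algebra all_fingroup all_solvable.
From mathcomp Require Import all_classical all_reals all_analysis.

Set Implicit Arguments.
Unset Strict Implicit.
Unset Printing Implicit Defensive.

Local Open Scope classical_set_scope.
Local Open Scope group_scope.

(** * Evaluation of words and homomorphisms *)

Lemma morph_mul1 (G H : groupType) (nu : G -> H) :
  {morph nu : x y / x * y} -> nu 1 = 1.
Proof. by move=> nuM; apply: (@mulgI _ (nu 1)); rewrite -nuM !mulg1. Qed.

Lemma morph_mulV (G H : groupType) (nu : G -> H) :
  {morph nu : x y / x * y} -> {morph nu : x / x^-1}.
Proof.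
by move=> nuM x; apply: (@mulgI _ (nu x)); rewrite -nuM !mulgV (morph_mul1 nuM).
Qed.

Section WordEval.
Variables (X : Type) (G : groupType) (rho : X -> G).

Lemma word_eval_cons l (u : word X) :
  word_eval rho (l :: u) =
  (if l.2 then (rho l.1)^-1 else rho l.1) * word_eval rho u.
Proof. by rewrite /word_eval big_cons. Qed.

Lemma word_eval_cat (u v : word X) :
  word_eval rho (u ++ v) = word_eval rho u * word_eval rho v.
Proof. by rewrite /word_eval big_cat. Qed.

Lemma word_eval_inv (u : word X) :
  word_eval rho (word_inv u) = (word_eval rho u)^-1.
Proof.
elim: u => [|[x b] u IH]; first by rewrite /word_eval !big_nil invg1.
rewrite /word_inv /= rev_cons -cats1 word_eval_cat [word_eval rho (rev _)]IH.
rewrite !word_eval_cons /word_eval big_nil mulg1 invgM.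
by case: b => //=; rewrite invgK.
Qed.

End WordEval.

Lemma word_eval_morph (X : Type) (G H : groupType) (nu : G -> H)
    (rho : X -> G) (u : word X) : {morph nu : x y / x * y} ->
  nu (word_eval rho u) = word_eval (nu \o rho) u.
Proof.
move=> nuM; elim: u => [|[x b] u IH].
  by rewrite /word_eval !big_nil (morph_mul1 nuM).
by rewrite !word_eval_cons nuM IH; case: b => //=; rewrite (morph_mulV nuM).
Qed.

Section FreeEval.
Variables (X : choiceType) (G : groupType) (rho : X -> G).

Definition free_eval (a : free_group X) : G := word_eval rho (free_word a).

(** Each [push_letter] either prepends its letter or cancels it against an adjacent inverse, and
    neither changes the product. *)
Lemma word_eval_reduce (u : word X) : word_eval rho (reduce u) = word_eval rho u.
Proof.
elim: u => //= l u IH; rewrite [RHS]word_eval_cons -IH.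
case: (reduce u) => [|k v] /=; first by rewrite word_eval_cons.
case: eqP => [->|_]; last by rewrite word_eval_cons.
by case: l => x [] /=; rewrite word_eval_cons /= ?mulKg ?mulVKg.
Qed.

Lemma free_evalM : {morph free_eval : a b / a * b}.
Proof. by move=> a b; rewrite /free_eval /= word_eval_reduce word_eval_cat. Qed.

Lemma free_eval_gen x : free_eval (free_gen x) = rho x.
Proof. by rewrite /free_eval /= word_eval_cons /word_eval big_nil mulg1. Qed.

End FreeEval.

Lemma morph_free2_of_word (G : groupType) (nu : free2 -> G) (u : word2) :
  {morph nu : x y / x * y} ->
  nu (free2_of_word u) =
  word2_eval (nu (free_gen false)) (nu (free_gen true)) u.
Proof.
move=> nuM; rewrite /free2_of_word (word_eval_morph _ _ nuM) /word2_eval.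
by congr word_eval; apply/funext => -[].
Qed.

Lemma word2_eval_morph (G H : groupType) (nu : G -> H) (g h : G) (u : word2) :
  {morph nu : x y / x * y} ->
  nu (word2_eval g h u) = word2_eval (nu g) (nu h) u.
Proof.
move=> nuM; rewrite /word2_eval (word_eval_morph _ _ nuM).
by congr word_eval; apply/funext => -[].
Qed.

(** * Persistence of trivial values along [u_seq] *)

Lemma u_seqS (w : word2) (n : nat) : (1 <= n)%N ->
  u_seq w n.+1 = word_comm (word_x ++ u_seq w n ++ word_inv word_x)
                           (word_y ++ u_seq w n ++ word_inv word_y).
Proof. by case: n. Qed.

(** When one term evaluates to 1, so do its two conjugates and their commutator, which is the next
    term. The bound on [m] is that of [u_seqS]: the recursion fails at index 0, where [u_seq] takes
    its junk value. *)
Lemma word2_eval_u_seq_le (G : groupType) (g h : G) (w : word2) (m n : nat) :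
  (1 <= m)%N -> (m <= n)%N ->
  word2_eval g h (u_seq w m) = 1 -> word2_eval g h (u_seq w n) = 1.
Proof.
move=> m1 /subnK <-; elim: (n - m)%N => // k IH /IH.
rewrite addSn u_seqS ?(leq_trans m1) ?leq_addl // /word2_eval /word_comm => e.
by rewrite !(word_eval_cat, word_eval_inv) e !mul1g !mulgV invg1 !mulg1.
Qed.

Lemma increasing_ge_id (phi : nat -> nat) :
  (forall m n : nat, (m < n)%N -> (phi m < phi n)%N) ->
  forall m, (m <= phi m)%N.
Proof.
move=> phi_incr; elim=> // m IH.
exact: leq_ltn_trans IH (phi_incr _ _ (ltnSn m)).
Qed.

(** * Extension of homomorphisms to the profinite completion *)

Lemma to_profinite_completionM (G : groupType) :
  {morph @to_profinite_completion G : x y / x * y}.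
Proof.
move=> x y; apply: val_inj; apply: functional_extensionality_dep => N /=.
by rewrite -quotient_projM.
Qed.

Lemma lim_projM (S : inverse_system) (i : sys_index S) :
  {morph @lim_proj S i : x y / x * y}.
Proof. by []. Qed.

Lemma lim_proj_inj (S : inverse_system) (x y : inverse_limit S) :
  (forall i, lim_proj i x = lim_proj i y) -> x = y.
Proof.
by move=> e; apply: val_inj; apply: functional_extensionality_dep => i; exact: e.
Qed.

Section FiniteKernel.
Variables (G : groupType) (H : finGroupType) (nu : G -> H).
Hypothesis nuM : {morph nu : x y / x * y}.

(** The cosets of the kernel are fibres of [nu], and these are indexed by the finite group [H]. *)
Lemma ker_finite_index : finite_set (range (coset_by [set g | nu g = 1])).
Proof.
apply: (@sub_finite_set _ _ ((fun a => [set g | nu g = a]) @` [set: H])).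
  move=> _ [g _ <-]; exists (nu g) => //; apply/seteqP; split=> x /=.
    move=> e; exists (g^-1 * x); last by rewrite mulVKg.
    by rewrite /= nuM (morph_mulV nuM) e mulVg.
  by move=> [a /= a1 <-]; rewrite nuM a1 mulg1.
by apply: finite_image; exact: finite_finset.
Qed.

(** Kept transparent so that membership computes to [nu g = 1]. *)
Definition ker_fin : fin_index_normal G.
Proof.
apply: (@FinIndexNormal G [set g | nu g = 1]) => /=.
- exact: morph_mul1.
- by move=> g h; rewrite nuM => -> ->; rewrite mulg1.
- by move=> g; rewrite (morph_mulV nuM) => ->; rewrite invg1.
- by move=> g h; rewrite /conjg !nuM (morph_mulV nuM) => ->; rewrite mul1g mulVg.
- exact: ker_finite_index.
Defined.

(** The default 1 of [xget] is never returned, since [quotient_proj] is surjective. *)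
Definition ker_fin_rep (q : quotient_by ker_fin) : G :=
  xget 1 (fun g => quotient_proj ker_fin g = q).

Definition lift_fin (z : profinite_completion G) : H :=
  nu (ker_fin_rep (@lim_proj (quotient_system G) ker_fin z)).

(** Two representatives of a coset of the kernel have the same image, so the choice made in
    [ker_fin_rep] does not matter. *)
Lemma lift_fin_proj z g :
  @lim_proj (quotient_system G) ker_fin z = quotient_proj ker_fin g ->
  lift_fin z = nu g.
Proof.
rewrite /lift_fin => ->; rewrite /ker_fin_rep; case: xgetP => [r _|]; last first.
  by move=> /(_ g).
move=> er; have /= := (coset_by_eq ker_fin _ _).1 (congr1 val er).
rewrite nuM (morph_mulV nuM) => e.
by apply: (@mulgI _ (nu r)^-1); rewrite e mulVg.
Qed.

End FiniteKernel.

Section Extension.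
Variables (G : groupType) (S : inverse_system) (nu : G -> inverse_limit S).
Hypothesis nuM : {morph nu : x y / x * y}.

Let nuM_ (i : sys_index S) : {morph @lim_proj S i \o nu : x y / x * y}.
Proof. by move=> x y; rewrite /= nuM. Qed.

Lemma lift_coherent (z : profinite_completion G) :
  (fun i : sys_index S => lift_fin (nuM_ i) z) \in @coherent S.
Proof.
rewrite inE => i j ij.
have [g eg] := quotient_projK (@lim_proj (quotient_system G) (ker_fin (nuM_ j)) z).
(* The component of [nu] at [i] factors through the one at [j], so the kernels are nested and the
   representative [g] chosen at [j] also serves at [i]. *)
have ker_le : ker_fin (nuM_ j) `<=` ker_fin (nuM_ i).
  by move=> x /= /(congr1 (sys_map ij)); rewrite sys_map1 (limP (nu x)).
rewrite (lift_fin_proj (esym eg)) (@lift_fin_proj _ _ _ _ _ g).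
  exact: (limP (nu g)).
have := @limP _ z (ker_fin (nuM_ i)) (ker_fin (nuM_ j)) ker_le.
by rewrite /lim_proj /= in eg *; rewrite -eg quotient_map_proj => <-.
Qed.

(** The existence half of the universal property of the profinite completion, for targets that are
    inverse limits of finite groups. *)
Definition lift_completion (z : profinite_completion G) : inverse_limit S :=
  exist (fun z => z \in @coherent S) _ (lift_coherent z).

Lemma lift_completion_cont_hom : continuous_hom lift_completion.
Proof.
split=> [x y|].
  apply: lim_proj_inj => i; rewrite lim_projM /lim_proj /=.
  have [g eg] := quotient_projK (@lim_proj (quotient_system G) (ker_fin (nuM_ i)) x).
  have [h eh] := quotient_projK (@lim_proj (quotient_system G) (ker_fin (nuM_ i)) y).
  rewrite (lift_fin_proj (esym eg)) (lift_fin_proj (esym eh)) -nuM_.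
  by apply: lift_fin_proj; rewrite lim_projM -eg -eh -quotient_projM.
(* The coordinate at [i] depends only on the coordinate of [z] at one finite quotient, which is
   locally constant. *)
apply: lim_continuous => i z.
have := @lim_proj_near (quotient_system G) (ker_fin (nuM_ i)) z.
by apply: filterS => y e; rewrite /lim_proj /= /lift_fin e.
Qed.

Lemma lift_completionE g : lift_completion (to_profinite_completion g) = nu g.
Proof. by apply: lim_proj_inj => i; exact: lift_fin_proj. Qed.

End Extension.

(** * The subsystem of images of the limit *)

Section ImageSystem.
Variable S : inverse_system.

(** The projections of the limit may fail to be surjective, so a property of the limit controls only
    these images and not all of [sys_group i]. *)
Definition lim_image_set (i : sys_index S) : {set sys_group i} :=
  [set g | `[< exists z : inverse_limit S, lim_proj i z = g >]]%SET.

Lemma lim_imageP (i : sys_index S) (g : sys_group i) :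
  reflect (exists z : inverse_limit S, lim_proj i z = g) (g \in lim_image_set i).
Proof. by rewrite inE; exact: asboolP. Qed.

Lemma lim_image_group_set (i : sys_index S) : group_set (lim_image_set i).
Proof.
apply/group_setP; split; first by apply/lim_imageP; exists 1.
move=> _ _ /lim_imageP[x <-] /lim_imageP[y <-].
by apply/lim_imageP; exists (x * y).
Qed.

Definition lim_image (i : sys_index S) : {group sys_group i} :=
  group (lim_image_group_set i).

Lemma lim_proj_image (i : sys_index S) (z : inverse_limit S) :
  lim_proj i z \in lim_image i.
Proof. by apply/lim_imageP; exists z. Qed.

Definition image_map (i j : sys_index S) (ij : sys_le i j)
  (x : subg_of (lim_image j)) : subg_of (lim_image i) :=
  subg (lim_image i) (sys_map ij (sgval x)).

(** By coherence a transition map sends a coordinate of a point of the limit to another coordinate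
    of that point, so [subg] never falls back on its default value in [image_map]. *)
Lemma image_mapE (i j : sys_index S) (ij : sys_le i j)
  (x : subg_of (lim_image j)) : sgval (image_map ij x) = sys_map ij (sgval x).
Proof.
rewrite /image_map subgK //; have /lim_imageP[z <-] := subgP x.
by rewrite /lim_proj limP lim_proj_image.
Qed.

Lemma sgvalMg (gT : finGroupType) (K : {group gT}) :
  {morph @sgval gT K : x y / x * y}.
Proof. by []. Qed.

Lemma image_mapM (i j : sys_index S) (ij : sys_le i j) :
  {morph image_map ij : x y / x * y}.
Proof.
by move=> x y; apply: val_inj; rewrite /= !(sgvalMg, image_mapE) sys_mapM.
Qed.

Lemma image_map_id (i : sys_index S) (ii : sys_le i i) x : image_map ii x = x.
Proof. by apply: val_inj; rewrite /= image_mapE sys_map_id. Qed.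

Lemma image_map_comp (i j k : sys_index S) (ij : sys_le i j) (jk : sys_le j k)
    (ik : sys_le i k) x : image_map ij (image_map jk x) = image_map ik x.
Proof. by apply: val_inj; rewrite /= !image_mapE (sys_map_comp _ _ ik). Qed.

Definition image_system : inverse_system :=
  @InverseSystem (sys_index S) (@sys_le S)
    (fun i => subg_of (lim_image i) : finGroupType) image_map
    (sys_inhabited S) (@sys_le_refl S) (@sys_le_trans S) (@sys_directed S)
    image_mapM image_map_id image_map_comp.

Lemma to_image_coherent (z : inverse_limit S) :
  (fun i : sys_index image_system => subg (lim_image i) (@lim_proj S i z))
    \in @coherent image_system.
Proof.
rewrite inE => i j ij; apply: val_inj; rewrite /= image_mapE.
by rewrite !subgK ?lim_proj_image // /lim_proj limP.
Qed.

Definition to_image (z : inverse_limit S) : inverse_limit image_system :=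
  exist (fun z => z \in @coherent image_system) _ (to_image_coherent z).

Lemma of_image_coherent (z : inverse_limit image_system) :
  (fun i : sys_index S => sgval (@lim_proj image_system i z))
    \in @coherent S.
Proof.
rewrite inE => i j ij; rewrite -image_mapE; congr sgval.
exact: (@limP image_system z i j ij).
Qed.

Definition of_image (z : inverse_limit image_system) : inverse_limit S :=
  exist (fun z => z \in @coherent S) _ (of_image_coherent z).

Lemma image_system_iso :
  topologically_isomorphic (inverse_limit S) (inverse_limit image_system).
Proof.
exists to_image, of_image; split.
- move=> z; apply: lim_proj_inj => i.
  by rewrite {1}/lim_proj /= subgK ?lim_proj_image.
- move=> z; apply: lim_proj_inj => i; rewrite {1}/lim_proj /=.
  by apply: val_inj; rewrite /= subgK // subgP.
- split=> [x y|].
    apply: lim_proj_inj => i; rewrite lim_projM /lim_proj /= -/(@lim_proj S i _).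
    by rewrite lim_projM subgM ?lim_proj_image.
  apply: lim_continuous => i z; have := @lim_proj_near S i z.
  by apply: filterS => y e; rewrite {1 2}/lim_proj /= e.
- split=> [x y|]; first exact: lim_proj_inj.
  apply: lim_continuous => i z.
  have := @lim_proj_near image_system i z.
  by apply: filterS => y e; rewrite {1 2}/lim_proj /= e.
Qed.

End ImageSystem.

(** * Continuous homomorphisms, convergence and the equivalence *)

Lemma continuous_hom_comp (G H K : topGroupType) (f : G -> H) (g : H -> K) :
  continuous_hom f -> continuous_hom g -> continuous_hom (g \o f).
Proof.
move=> [fM fc] [gM gc]; split=> [x y|x]; first by rewrite /= fM gM.
exact: (@continuous_comp _ _ _ f g x (fc x) (gc (f x))).
Qed.

Lemma topologically_isomorphic_trans (G H K : topGroupType) :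
  topologically_isomorphic G H -> topologically_isomorphic H K ->
  topologically_isomorphic G K.
Proof.
move=> [f [f' [fK f'K fh f'h]]] [g [g' [gK g'K gh g'h]]].
exists (g \o f), (f' \o g'); split; try exact: continuous_hom_comp.
- exact: can_comp.
- exact: can_comp.
Qed.

(** The fibre of [lim_proj i \o mu] through [l] is a neighbourhood of [l], so the sequence is
    eventually inside it. *)
Lemma cvg_lim_proj_eq (G : topGroupType) (S : inverse_system)
    (mu : G -> inverse_limit S) (v : nat -> G) (l : G) (i : sys_index S) (n : nat) :
  continuous mu -> v @ \oo --> l ->
  exists2 m, (n <= m)%N & lim_proj i (mu (v m)) = lim_proj i (mu l).
Proof.
move=> cmu vl.
have near_v : \forall m \near \oo, lim_proj i (mu (v m)) = lim_proj i (mu l).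
  exact: (vl _ (cmu l _ (lim_proj_near i (mu l)))).
have [m [em nm]] := filter_ex (filterI near_v (nbhs_infty_ge n)).
by exists m.
Qed.

Theorem theorem1p13 (w : word2)
  (hw : forall G : finGroupType, finite_solvable G <->
          exists n : nat, (1 <= n)%N /\ identity_holds G (u_seq w n))
  (phi : nat -> nat)
  (phi_ge1 : forall m : nat, (1 <= phi m)%N)
  (phi_incr : forall m n : nat, (m < n)%N -> (phi m < phi n)%N)
  (f : profinite_completion free2)
  (hf : (fun m : nat =>
           to_profinite_completion (free2_of_word (u_seq w (phi m))))
          @ \oo --> f)
  (Gamma : topGroupType) (hGamma : profinite Gamma) :
  prosolvable Gamma <-> profinite_identity_holds Gamma f.
Proof.
split.
  move=> [S [Ssol [a [b [aK _ ah _]]]]] mu muh.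
  have [[aM _] [muM _]] := (ah, muh).
  apply: (can_inj aK); rewrite (morph_mul1 aM); apply: lim_proj_inj => i.
  have [_ amuc] := continuous_hom_comp muh ah.
  have [n [n1 un]] := (hw _).1 (Ssol i).
  have [m nm /= <-] := cvg_lim_proj_eq i n amuc hf.
  (* Restricted to the free group, the map is a homomorphism into a finite solvable group, so it
     evaluates each word at the images of the two generators. *)
  pose nu (g : free2) := lim_proj i (a (mu (to_profinite_completion g))).
  have nuM : {morph nu : x y / x * y}.
    by move=> x y; rewrite /nu to_profinite_completionM muM aM.
  rewrite -/(nu _) (morph_free2_of_word _ nuM).
  apply: word2_eval_u_seq_le n1 _ (un _ _).
  exact: leq_trans nm (increasing_ge_id phi_incr m).
move=> idf; have [S [_ iso]] := hGamma.
exists (image_system S); split; last first.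
  exact: topologically_isomorphic_trans iso (image_system_iso S).
move: iso => [a [b [_ bK _ bh]]].
change (forall i : sys_index S, finite_solvable (subg_of (lim_image i))).
move=> i; apply/hw.
have pw (p : subg_of (lim_image i) * subg_of (lim_image i)) :
    exists n, (1 <= n)%N /\ word2_eval p.1 p.2 (u_seq w n) = 1.
  case: p => g h /=.
  have [[x ex] [y ey]] := (lim_imageP _ (subgP g), lim_imageP _ (subgP h)).
  (* The generators go to lifts of [g] and [h] in the limit, so that [mu] followed by [lim_proj i]
     evaluates words at [g] and [h]. *)
  pose rho (c : bool) := if c then y else x.
  pose mu := lift_completion (@free_evalM _ _ rho).
  have muh := lift_completion_cont_hom (@free_evalM _ _ rho).
  have muf : mu f = 1.
    (* The hypothesis concerns maps into [Gamma]; the injective [b] carries [mu] there. *)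
    apply: (can_inj bK); rewrite (morph_mul1 bh.1).
    exact: (idf (b \o mu) (continuous_hom_comp muh bh)).
  have [m _ em] := cvg_lim_proj_eq i 0 muh.2 hf.
  exists (phi m); split=> //; apply: val_inj; rewrite /=.
  move: em; rewrite lift_completionE -/mu muf.
  rewrite (morph_free2_of_word _ (@free_evalM _ _ rho)) !free_eval_gen /rho.
  rewrite (word2_eval_morph _ _ _ (@lim_projM S i)) ex ey.
  by rewrite -(word2_eval_morph _ _ _ (@sgvalMg _ (lim_image i))).
have [n hn] := choice pw.
(* The maximum runs over the finitely many pairs; the successor makes the index visibly positive. *)
exists (\max_p n p).+1; split=> // g h.
apply: word2_eval_u_seq_le (hn (g, h)).1 _ (hn (g, h)).2.
by apply: leqW; exact: (leq_bigmax (g, h)).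
Qed.
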